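(* Let $n\ge 1$, let $f$ be a real homogeneous polynomial of degree $3$ in the variables $x_1,\dots,x_n$, and let $r\ge 3$ be an integer. Then $$f_{\Delta(n,r)}-f_{\min}^{(r-3)}\le \frac{4r}{(r-1)(r-2)}\left(\overline{f}-\underline{f}\right).$$
   Context: The standard simplex is $\Delta_n:=\{x\in\mathbb{R}^n: x_i\ge 0 \text{ for all } i,\ \sum_{i=1}^n x_i=1\}$. Put $\underline{f}:=\min_{x\in\Delta_n}f(x)$ and $\overline{f}:=\max_{x\in\Delta_n}f(x)$. For an integer $r\ge 1$, the regular grid is $\Delta(n,r):=\{x\in\Delta_n: rx\in\mathbb{N}^n\}$, where $\mathbb{N}^n$ is the set of nonnegative integer vectors, and $f_{\Delta(n,r)}:=\min_{x\in\Delta(n,r)}f(x)$. For a real homogeneous polynomial $f$ of degree $d$ in $x_1,\dots,x_n$ and an integer $r\ge d$, the quantity $f_{\min}^{(r-d)}$ is the maximum of all real $\lambda$ such that the polynomial $\left(\sum_{i=1}^n x_i\right)^{r-d}\left(f-\lambda\left(\sum_{i=1}^n x_i\right)^d\right)$ has only nonnegative coefficients; here $d=3$. *)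

(* Defs.v *)
(* [mpoly] must be imported before the MathComp-Analysis files: in the other
   order their notations clash. *)
From mathcomp Require Import all_boot all_order all_algebra.
From mathcomp Require Import mpoly.
From mathcomp Require Import boolp classical_sets reals.

Set Implicit Arguments.
Unset Strict Implicit.
Unset Printing Implicit Defensive.

Import Order.TTheory GRing.Theory Num.Theory.

Local Open Scope classical_set_scope.
Local Open Scope ring_scope.

(* The least (resp. greatest) element of A, or the default value 0 if there is
   none. *)
Definition min_of (R : realType) (A : set R) : R := xget 0 (A `&` lbound A).

Definition max_of (R : realType) (A : set R) : R := xget 0 (A `&` ubound A).

Definition simplex (R : realType) (n : nat) : set ('I_n -> R) :=
  [set x | (forall i, 0 <= x i) /\ \sum_(i < n) x i = 1].

Arguments simplex R n : clear implicits.

Definition grid (R : realType) (n r : nat) : set ('I_n -> R) :=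
  [set x | simplex R n x /\ forall i, r%:R * x i \is a Num.nat].
Arguments grid R n r : clear implicits.

Definition min_on (R : realType) (n : nat) (D : set ('I_n -> R))
    (f : {mpoly R[n]}) : R :=
  min_of [set f.@[x] | x in D].

Definition max_on (R : realType) (n : nat) (D : set ('I_n -> R))
    (f : {mpoly R[n]}) : R :=
  max_of [set f.@[x] | x in D].

Definition sum_vars (R : realType) (n : nat) : {mpoly R[n]} :=
  \sum_(i < n) 'X_i.

(* Meaningful for d <= r only, since r - d is truncated; d is the degree of f,
   passed explicitly because f = 0 is homogeneous of every degree. *)
Definition polya_bound (R : realType) (n d r : nat) (f : {mpoly R[n]}) : R :=
  max_of [set lambda : R | forall m : 'X_{1..n},
    0 <= (sum_vars R n ^+ (r - d) * (f - lambda *: sum_vars R n ^+ d))@_m].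

(* Main.v *)
(* Write s for the sum of the variables and put c_m(p) = m! * p@_m.  Then
   c_m('X_i * p) = m_i * c_(m - U_i)(p), so c_m(s^r) = r! when mdeg m = r, and
   the Polya bound is the minimum of c_m(s^(r-3) f) / r! over those m.  For a
   cubic f and x = m / r,
     c_m(s^(r-3) f) / (r-3)! = r^3 f(x) - r^2 Q(x) / 2 + 2 r L(x),
   where L(x) = sum_i f(e_i) x_i and
   Q(x) = sum_(i,j) (8 f((e_i + e_j) / 2) - f(e_i) - f(e_j)) x_i x_j; by
   linearity it is enough to check this on products of three variables.
   On the simplex Q <= 8 max f - 2 L, L >= min f and f(x) >= min f, which
   bounds f(x) minus the Polya bound for the grid point x of a minimizing m. *)
Require Import Defs.
From mathcomp Require Import all_boot all_order all_algebra.
From mathcomp Require Import mpoly.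
From mathcomp Require Import boolp classical_sets reals.
From mathcomp Require Import topology normedtype derive.
From mathcomp Require Import ring lra.

Import Order.TTheory GRing.Theory Num.Theory.
Import numFieldNormedType.Exports.

Set Implicit Arguments.
Unset Strict Implicit.

Local Open Scope ring_scope.
Local Open Scope classical_set_scope.

(** * Attained extrema, and continuity of polynomials on the simplex *)

(** The witness [a] rules out the default value 0 in [min_of]. *)
Lemma min_of_lbound (R : realType) (A : set R) (a : R) :
  A a -> lbound A a -> lbound A (min_of A).
Proof.
move=> Aa lba; rewrite /min_of.
by have [] := xgetPex 0 (ex_intro (A `&` lbound A) a (conj Aa lba)).
Qed.

Lemma max_of_ubound (R : realType) (A : set R) (a : R) :
  A a -> ubound A a -> ubound A (max_of A).
Proof.
move=> Aa uba; rewrite /max_of.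
by have [] := xgetPex 0 (ex_intro (A `&` ubound A) a (conj Aa uba)).
Qed.

Lemma max_ofE (R : realType) (A : set R) (a : R) :
  A a -> ubound A a -> max_of A = a.
Proof.
move=> Aa uba; rewrite /max_of.
have [Ab ubb] := xgetPex 0 (ex_intro (A `&` ubound A) a (conj Aa uba)).
by apply/eqP; rewrite eq_le uba//= ubb.
Qed.

Lemma meval_continuous (R : realType) (n : nat) (p : {mpoly R[n]}) :
  continuous (fun v : 'rV[R]_n => p.@[v ord0]).
Proof.
have cD (F G : 'rV[R]_n -> R) : continuous F -> continuous G ->
    continuous (fun v => F v + G v).
  by move=> cF cG v; exact: continuousD (cF v) (cG v).
have cM (F G : 'rV[R]_n -> R) : continuous F -> continuous G ->
    continuous (fun v => F v * G v).
  by move=> cF cG v; exact: continuousM (cF v) (cG v).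
have cX m : continuous (fun v : 'rV[R]_n => \prod_(i < n) v ord0 i ^+ m i).
  elim: (index_enum _) => [|i s IHs].
    rewrite (_ : (fun _ => _) = fun=> 1); first exact: cst_continuous.
    by apply/funext => w; rewrite big_nil.
  under eq_fun do rewrite big_cons.
  apply: (cM); last exact: IHs.
  elim: (m i) => [|k IHk]; first exact: cst_continuous.
  under eq_fun do rewrite exprS.
  by apply: (cM); [exact: coord_continuous|exact: IHk].
elim/mpolyind: p => [|c m p _ _ IHp].
  rewrite (_ : (fun _ => _) = fun=> 0); first exact: cst_continuous.
  by apply/funext => w; rewrite meval0.
under eq_fun do rewrite mevalD mevalZ mevalX.
by apply: (cD); [apply: (cM); [exact: cst_continuous|exact: cX]|exact: IHp].
Qed.

(** The simplex is compact: it lies in the cube [0, 1]^n and is cut out by closed conditions on the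
    polynomials ['X_i] and [sum_vars]. So [f] attains both extrema, and neither [min_on] nor
    [max_on] falls back on a default. *)
Lemma simplex_extrema (R : realType) (n : nat) (f : {mpoly R[n]}) x :
  simplex R n x -> min_on (simplex R n) f <= f.@[x] <= max_on (simplex R n) f.
Proof.
move=> Dx.
pose D := [set v : 'rV[R]_n | simplex R n (v ord0)].
have cD : compact D.
  apply: (@subclosed_compact _ _
    [set v : 'rV[R]_n | forall i, `[0, 1]%classic (v ord0 i)]).
  - rewrite (_ : D = (\bigcap_(i in [set: 'I_n])
        ((fun v : 'rV[R]_n => ('X_i : {mpoly R[n]}).@[v ord0]) @^-1`
          [set y | 0 <= y]) `&`
        (fun v : 'rV[R]_n => (sum_vars R n).@[v ord0]) @^-1` [set 1])).
      apply: closedI; [apply: closed_bigI => i _|];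
        apply: closed_comp => [v _|]; try exact: meval_continuous.
        exact: closed_ge.
      exact: closed_eq.
    apply/seteqP; split => v /=.
      move=> [v0 v1]; split; first by move=> i _ /=; rewrite mevalXU.
      rewrite /sum_vars rmorph_sum -v1; apply: eq_bigr => i _.
      exact: mevalXU.
    move=> [v0 v1]; split; first by move=> i; have := v0 i I; rewrite /= mevalXU.
    rewrite -v1 /sum_vars rmorph_sum; apply: eq_bigr => i _.
    exact: esym (mevalXU _ _).
  - by apply: (@rV_compact R n (fun=> `[0 : R, 1]%classic)) => _; exact: segment_compact.
  - move=> v [v0 v1] i /=; rewrite in_itv/= v0 -v1 (bigD1 i)//= lerDl.
    by apply: sumr_ge0 => j _.
have cf : {within D, continuous (fun v : 'rV[R]_n => f.@[v ord0])}.
  by apply: continuous_subspaceT; exact: meval_continuous.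
have rowD y : simplex R n y ->
    (\row_i y i) \in D /\ f.@[y] = f.@[(\row_i y i : 'rV[R]_n) ord0].
  move=> Dy; split; last by apply: meval_eq => i; rewrite mxE.
  rewrite inE/D/=; case: Dy => y0 y1; split => [i|]; first by rewrite mxE.
  by under eq_bigr do rewrite mxE.
have D0 : D !=set0 by exists (\row_i x i); exact: set_mem (rowD x Dx).1.
have [c /set_mem Dc fc] := EVT_min_rV D0 cD cf.
have [d /set_mem Dd fd] := EVT_max_rV D0 cD cf.
apply/andP; split.
  apply: (@min_of_lbound _ _ f.@[c ord0]); [by exists (c ord0)| |by exists x].
  by move=> _ [y /rowD[Dy ->] <-]; exact: fc.
apply: (@max_of_ubound _ _ f.@[d ord0]); [by exists (d ord0)| |by exists x].
by move=> _ [y /rowD[Dy ->] <-]; exact: fd.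
Qed.

(** * Coefficients scaled by factorials *)

(** The coefficient of [p] read as an exponential generating function, i.e. the partial derivative
    of multi-index [m] at 0. *)
Definition egf_coef (R : realType) (n : nat) (m : 'X_{1..n}) (p : {mpoly R[n]}) : R :=
  (\prod_(i < n) (m i)`!)%:R * p@_m.

(** If m_i > 0, then m! = m_i (m - U_i)!. If m_i = 0, the truncated difference is [m] itself, but
    both sides vanish. *)
Lemma egf_coef_XM (R : realType) (n : nat) (m : 'X_{1..n}) (i : 'I_n)
    (p : {mpoly R[n]}) :
  egf_coef m ('X_i * p) = (m i)%:R * egf_coef (m - U_(i))%MM p.
Proof.
rewrite /egf_coef (mulrC 'X_i).
have [mi0|mi_neq0] := eqVneq (m i) 0%N.
  rewrite mi0 mul0r memN_msupp_eq0 ?mulr0// (perm_mem (msuppMX _ _)).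
  by apply/mapP => -[m' _ mE]; move: mi0; rewrite mE mnmDE mnm1E eqxx.
have mE : m = (U_(i) + (m - U_(i)))%MM by rewrite addmC submK// lep1mP.
have -> : (p * 'X_i)@_m = p@_(m - U_(i)) by rewrite {1}mE mcoeffMX.
rewrite mulrA -natrM; congr (_%:R * _).
rewrite (bigD1 i)//= [in RHS](bigD1 i)//= mulnA; congr (_ * _)%N.
  by rewrite mnmBE mnm1E eqxx subn1; case: (m i) mi_neq0.
by apply: eq_bigr => j ji; rewrite mnmBE mnm1E eq_sym (negPf ji) subn0.
Qed.

Lemma mdeg_subU (n k : nat) (m : 'X_{1..n}) (i : 'I_n) :
  m i != 0%N -> mdeg m = k.+1 -> mdeg (m - U_(i))%MM = k.
Proof.
move=> mi mk; apply/eqP; rewrite -(eqn_add2r 1) -{1}(mdeg1 i) -mdegD submK.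
  by rewrite mk addn1.
by rewrite lep1mP.
Qed.

(** The multinomial theorem: peeling off one factor s leaves the sum of the m_i k!, which is (k+1)
    k! in degree k+1. *)
Lemma egf_coef_sum_vars (R : realType) (n k : nat) (m : 'X_{1..n}) :
  mdeg m = k -> egf_coef m (sum_vars R n ^+ k) = k`!%:R.
Proof.
elim: k m => [|k IHk] m mk.
  have /eqP -> : m == 0%MM by rewrite -mdeg_eq0 mk.
  rewrite /egf_coef mcoeff1 eqxx mulr1 big1// => i _.
  by rewrite mnm0E.
rewrite exprS /sum_vars mulr_suml -/(sum_vars R n) /egf_coef.
rewrite raddf_sum mulr_sumr /= factS -mk mdegE natrM natr_sum mulr_suml.
apply: eq_bigr => i _; rewrite -/(egf_coef m _) egf_coef_XM.
have [->|mi] := eqVneq (m i) 0%N; first by rewrite !mul0r.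
by rewrite IHk//; exact: mdeg_subU.
Qed.

(** Splitting each monomial into three variables reduces an identity linear in [f] to products of
    three variables. *)
Lemma homog3_ind (R : realType) (n : nat) (P : {mpoly R[n]} -> Prop) :
  P 0 -> (forall p q, P p -> P q -> P (p + q)) ->
  (forall c p, P p -> P (c *: p)) ->
  (forall a b c, P ('X_a * 'X_b * 'X_c)) ->
  forall f, f \is 3.-homog -> P f.
Proof.
move=> P0 PD PZ PX f /dhomogP fh.
rewrite (mpolyE f) big_seq; apply: (big_ind P) => // m mf; apply: PZ.
have degS k (u : 'X_{1..n}) : mdeg u = k.+1 ->
    exists i (v : 'X_{1..n}), mdeg v = k /\ u = (v + U_(i))%MM.
  move=> uk; have [i ui|u0] := pickP (fun i => u i != 0%N).
    exists i, (u - U_(i))%MM; split; first exact: mdeg_subU.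
    by rewrite submK// lep1mP.
  by move: uk; rewrite mdegE big1// => i _; have /negbFE/eqP := u0 i.
have [c [v [vE ->]]] := degS _ _ (fh m mf).
have [b [w [wE ->]]] := degS _ _ vE.
have [a [z [/eqP zE ->]]] := degS _ _ wE.
move: zE; rewrite mdeg_eq0 => /eqP ->.
by rewrite add0m !mpolyXD.
Qed.

(** * The coefficient formula for cubics *)

Definition vtx (R : realType) (n : nat) (i : 'I_n) : 'I_n -> R :=
  fun k => (i == k)%:R.
Arguments vtx R {n}.

Definition mid (R : realType) (n : nat) (i j : 'I_n) : 'I_n -> R :=
  fun k => (vtx R i k + vtx R j k) / 2.
Arguments mid R {n}.

Definition vertex_form (R : realType) (n : nat) (x : 'I_n -> R) (f : {mpoly R[n]}) : R :=
  \sum_i f.@[vtx R i] * x i.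

(** For a cubic, 8 f((e_i + e_j) / 2) = f(e_i + e_j); the midpoint is used because it lies in the
    simplex, where [f] is bounded by its maximum. *)
Definition edge_form (R : realType) (n : nat) (x : 'I_n -> R) (f : {mpoly R[n]}) : R :=
  \sum_i \sum_j (8 * f.@[mid R i j] - f.@[vtx R i] - f.@[vtx R j]) * (x i * x j).

(** On X_a X_b X_c, with D the Kronecker delta, the left side is k! m_a (m_b - D_ab) (m_c - D_ac -
    D_bc). Substituting m = r x and sorting by powers of r gives the three terms on the right. *)
Lemma egf_coef_cubic (R : realType) (n k : nat) (f : {mpoly R[n]}) (m : 'X_{1..n})
    (r : R) (x : 'I_n -> R) :
  f \is 3.-homog -> mdeg m = (k + 3)%N -> (forall i, (m i)%:R = r * x i) ->
  egf_coef m (sum_vars R n ^+ k * f) =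
  k`!%:R * (r ^+ 3 * f.@[x] - r ^+ 2 * (edge_form x f / 2) + 2 * r * vertex_form x f).
Proof.
move=> fh mk mx; move: f fh; apply: homog3_ind.
- rewrite /egf_coef /edge_form /vertex_form mulr0 mcoeff0 meval0.
  rewrite [X in X / 2]big1 => [|i _].
    by rewrite [X in _ * r * X]big1 => [|i _]; [ring|rewrite meval0 mul0r].
  by rewrite big1// => j _; rewrite !meval0; ring.
- move=> p q Hp Hq; have -> : edge_form x (p + q) = edge_form x p + edge_form x q.
    rewrite /edge_form -big_split; apply: eq_bigr => i _.
    by rewrite -big_split; apply: eq_bigr => j _; rewrite !mevalD/=; ring.
  have -> : vertex_form x (p + q) = vertex_form x p + vertex_form x q.
    by rewrite /vertex_form -big_split; apply: eq_bigr => i _; rewrite mevalD mulrDl.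
  rewrite mevalD /egf_coef [_ * (p + q)]mulrDr mcoeffD mulrDr -!/(egf_coef _ _) Hp Hq.
  by ring.
- move=> c p Hp; have -> : edge_form x (c *: p) = c * edge_form x p.
    rewrite /edge_form mulr_sumr; apply: eq_bigr => i _.
    by rewrite mulr_sumr; apply: eq_bigr => j _; rewrite !mevalZ/=; ring.
  have -> : vertex_form x (c *: p) = c * vertex_form x p.
    by rewrite /vertex_form mulr_sumr; apply: eq_bigr => i _; rewrite mevalZ mulrA.
  rewrite mevalZ /egf_coef -scalerAr mcoeffZ mulrCA -/(egf_coef _ _) Hp.
  by ring.
move=> a b c.
pose D i j : R := (i == j :> 'I_n)%:R.
have S1 j : \sum_i D i j * x i = x j.
  rewrite (bigD1 j)//= big1 ?addr0 /D ?eqxx ?mul1r// => i /negPf ->.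
  by rewrite mul0r.
have S2 j l : \sum_i D i j * D i l * x i = D j l * x j.
  rewrite (bigD1 j)//= big1 ?addr0 /D ?eqxx ?mul1r// => i /negPf ->.
  by rewrite !mul0r.
have S3 : vertex_form x ('X_a * 'X_b * 'X_c) = D a b * D a c * x a.
  rewrite /vertex_form (bigD1 a)//= big1 ?addr0 /D.
    by rewrite !mevalM !mevalXU /vtx eqxx mul1r.
  by move=> i /negPf ia; rewrite !mevalM !mevalXU /vtx ia !mul0r.
have SE : edge_form x ('X_a * 'X_b * 'X_c) =
    2 * (D a b * x a * x c + D a c * x a * x b + D b c * x b * x a).
  (* The factor 2 is spent on writing each term in both orders, so that the double sums over (i, j)
     agree summand by summand. *)
  have -> : 2 * (D a b * x a * x c + D a c * x a * x b + D b c * x b * x a) =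
    D a b * x a * x c + D a c * x a * x b + D b c * x b * x a +
    (x c * (D a b * x a) + x b * (D a c * x a) + x a * (D b c * x b)) by ring.
  rewrite -!S2 -(S1 a) -(S1 b) -(S1 c) !big_distrlr/= -!big_split/=.
  apply: eq_bigr => i _; rewrite -!big_split/=; apply: eq_bigr => j _.
  by rewrite !mevalM !mevalXU /mid /vtx -!/(D _ _); field.
rewrite S3 SE mulrC -!mulrA !egf_coef_XM !mevalM !mevalXU.
(* The factor u_i guards the truncated subtraction: where it would be wrong, both sides are 0. *)
have stepE (u : 'X_{1..n}) i j :
    (u i)%:R * ((u - U_(i))%MM j)%:R = (u i)%:R * ((u j)%:R - D i j) :> R.
  have [->|ui] := eqVneq (u i) 0%N; first by rewrite !mul0r.
  rewrite mnmBE mnm1E natrB//; case: eqP => // <-.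
  by rewrite lt0n.
set m1 := (m - U_(a))%MM; set m2 := (m1 - U_(b))%MM.
(* Unless a factor vanishes, the remaining exponent has degree k and its scaled coefficient in s^k
   is k!. *)
have -> : (m a)%:R * ((m1 b)%:R * ((m2 c)%:R * egf_coef (m2 - U_(c))%MM (sum_vars R n ^+ k)))
   = (m a)%:R * ((m1 b)%:R * ((m2 c)%:R * k`!%:R)) :> R.
  have [->|ma] := eqVneq (m a) 0%N; first by rewrite !mul0r.
  have [->|m1b] := eqVneq (m1 b) 0%N; first by rewrite !(mul0r, mulr0).
  have [->|m2c] := eqVneq (m2 c) 0%N; first by rewrite !(mul0r, mulr0).
  rewrite egf_coef_sum_vars//; apply: mdeg_subU => //.
  by do 2!apply: mdeg_subU => //; rewrite mk !addnS addn0.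
have -> : (m a)%:R * ((m1 b)%:R * ((m2 c)%:R * k`!%:R)) =
    (m a)%:R * ((m b)%:R - D a b) * ((m c)%:R - D a c - D b c) * k`!%:R :> R.
  have Eb := stepE m a b; have Ec := stepE m a c; have Ec' := stepE m1 b c.
  rewrite -/m1 in Eb Ec; rewrite -/m2 in Ec'.
  rewrite (mulrA (m1 b)%:R) Ec' !mulrA Eb.
  transitivity (((m a)%:R * (m1 c)%:R - (m a)%:R * D b c) * ((m b)%:R - D a b) * k`!%:R).
    by ring.
  by rewrite Ec; ring.
have Dxx i : D i i = 1 by rewrite /D eqxx.
have Dne i j : i != j -> D i j = 0 by move=> /negPf ij; rewrite /D ij.
rewrite !mx.
(* The deltas satisfy relations such as D_ab D_ac = D_ab D_bc, so the identity is checked for each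
   pattern of equal indices. *)
have [<-|ab] := eqVneq a b.
  have [<-|ac] := eqVneq a c; first by rewrite !Dxx; field.
  by rewrite Dxx (Dne a c)//; field.
have [<-|ac] := eqVneq a c.
  by rewrite Dxx (Dne a b)// (Dne b a) 1?eq_sym//; field.
have [<-|bc] := eqVneq b c; first by rewrite Dxx !Dne//; field.
by rewrite !Dne//; field.
Qed.

(** * Bounds for the vertex and edge forms on the simplex *)

Lemma sum_vtx (R : realType) (n : nat) (i : 'I_n) : \sum_j vtx R i j = 1.
Proof.
by rewrite (bigD1 i)//= /vtx eqxx big1 ?addr0// => j; rewrite eq_sym => /negPf ->.
Qed.

Lemma simplex_vtx (R : realType) (n : nat) (i : 'I_n) : simplex R n (vtx R i).
Proof. by split; [move=> j; exact: ler0n|exact: sum_vtx]. Qed.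

Lemma simplex_mid (R : realType) (n : nat) (i j : 'I_n) : simplex R n (mid R i j).
Proof.
split=> [l|]; first by rewrite divr_ge0// addr_ge0// ler0n.
by rewrite -mulr_suml big_split/= !sum_vtx; field.
Qed.

(** Only the midpoint values are estimated. The vertex values add up to exactly -2 L, which is kept
    because L is bounded below later. *)
Lemma edge_form_le (R : realType) (n : nat) (f : {mpoly R[n]}) (M : R) (x : 'I_n -> R) :
  (forall y, simplex R n y -> f.@[y] <= M) -> simplex R n x ->
  edge_form x f <= 8 * M - 2 * vertex_form x f.
Proof.
move=> fM [x0 x1]; have -> : 8 * M - 2 * vertex_form x f =
    \sum_i \sum_j (8 * M - f.@[vtx R i] - f.@[vtx R j]) * (x i * x j).
  have -> : 8 * M - 2 * vertex_form x f = 8 * M * ((\sum_i x i) * (\sum_j x j))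
      - vertex_form x f * (\sum_j x j) - (\sum_i x i) * vertex_form x f.
    by rewrite x1; ring.
  rewrite /vertex_form !big_distrlr/= mulr_sumr -!sumrB; apply: eq_bigr => i _.
  by rewrite mulr_sumr -!sumrB; apply: eq_bigr => j _; ring.
apply: ler_sum => i _; apply: ler_sum => j _.
by rewrite ler_wpM2r ?mulr_ge0// !lerD2r ler_wpM2l// fM//; exact: simplex_mid.
Qed.

Lemma vertex_form_ge (R : realType) (n : nat) (f : {mpoly R[n]}) (c : R) (x : 'I_n -> R) :
  (forall y, simplex R n y -> c <= f.@[y]) -> simplex R n x -> c <= vertex_form x f.
Proof.
move=> fc [x0 x1]; rewrite -[c]mulr1 -x1 mulr_sumr.
by apply: ler_sum => i _; rewrite ler_wpM2r// fc//; exact: simplex_vtx.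
Qed.

(** * The Polya bound as a minimum over exponents *)

(** Exponents of degree [r] lie in the finite type ['X_{1..n < r.+1}]; a power of the first variable
    shows that there is one. *)
Lemma mdeg_arg_min (R : realType) (n r : nat) (F : 'X_{1..n} -> R) : (0 < n)%N ->
  exists2 m, mdeg m = r & forall m', mdeg m' = r -> F m <= F m'.
Proof.
move=> n0; have r0 : (mdeg (U_(Ordinal n0) *+ r)%MM < r.+1)%N.
  by rewrite mdegMn mdeg1 mul1n.
have Pm0 : mdeg (BMultinom r0) == r by rewrite /= mdegMn mdeg1 mul1n.
case: (arg_minP (P := fun m : 'X_{1..n < r.+1} => mdeg m == r)
  (fun m => F m) Pm0) => m /eqP mr Fm.
exists m => // m' m'r; have m'r1 : (mdeg m' < r.+1)%N by rewrite m'r.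
by apply: (Fm (BMultinom m'r1)); rewrite /= m'r.
Qed.

Lemma sum_vars_homog (R : realType) (n k : nat) : sum_vars R n ^+ k \is k.-homog.
Proof.
rewrite -[X in X.-homog]mul1n; apply: dhomogMn.
by apply: rpred_sum => i _; rewrite dhomogX /= mdeg1.
Qed.

Lemma egf_coefB (R : realType) (n : nat) (m : 'X_{1..n}) (p q : {mpoly R[n]}) :
  egf_coef m (p - q) = egf_coef m p - egf_coef m q.
Proof. by rewrite /egf_coef mcoeffB mulrBr. Qed.

Lemma egf_coefZ (R : realType) (n : nat) (m : 'X_{1..n}) c (p : {mpoly R[n]}) :
  egf_coef m (c *: p) = c * egf_coef m p.
Proof. by rewrite /egf_coef mcoeffZ mulrCA. Qed.

Lemma egf_coef_ge0 (R : realType) (n : nat) (m : 'X_{1..n}) (p : {mpoly R[n]}) :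
  (0 <= egf_coef m p) = (0 <= p@_m).
Proof.
rewrite /egf_coef pmulr_rge0// ltr0n prodn_gt0// => i; exact: fact_gt0.
Qed.

(** In degree r the scaled coefficient is c_m(s^(r-d) f) - lambda r!, so the admissible lambda form
    a half-line ending at the smallest quotient. *)
Lemma polya_boundP (R : realType) (n d r : nat) (f : {mpoly R[n]}) :
  (0 < n)%N -> (d <= r)%N -> f \is d.-homog ->
  exists2 m, mdeg m = r &
    polya_bound d r f = egf_coef m (sum_vars R n ^+ (r - d) * f) / r`!%:R.
Proof.
move=> n0 dr fd.
have [m mr mmin] :=
  mdeg_arg_min r (fun m => egf_coef m (sum_vars R n ^+ (r - d) * f)) n0.
exists m => //.
have r0 : 0 < r`!%:R :> R by rewrite ltr0n fact_gt0.
have polyaE l m' : mdeg m' = r ->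
    (0 <= (sum_vars R n ^+ (r - d) * (f - l *: sum_vars R n ^+ d))@_m') =
    (l <= egf_coef m' (sum_vars R n ^+ (r - d) * f) / r`!%:R).
  move=> m'r; rewrite -egf_coef_ge0 mulrBr -scalerAr -exprD subnK//.
  by rewrite egf_coefB egf_coefZ egf_coef_sum_vars// subr_ge0 ler_pdivlMr.
apply: max_ofE => [m'|l /(_ m)]; last by rewrite polyaE.
have [m'r|m'r] := eqVneq (mdeg m') r.
  by rewrite polyaE// ler_pM2r ?invr_gt0// mmin.
(* Outside degree r the coefficient is 0 by homogeneity. *)
rewrite (dhomog_nemf_coeff (mf := mdeg) (d := r))// -[X in X.-homog](subnK dr).
apply: dhomogM; first exact: sum_vars_homog.
by rewrite rpredB// dhomogZ// sum_vars_homog.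
Qed.

(** * Grid points as exponents of degree [r] divided by [r] *)

Lemma grid_mnm (R : realType) (n r : nat) (m : 'X_{1..n}) :
  (0 < r)%N -> mdeg m = r -> grid R n r (fun i => (m i)%:R / r%:R).
Proof.
move=> r0 mr; have rn0 : r%:R != 0 :> R by rewrite pnatr_eq0 -lt0n.
split; first split=> [i|]; first by rewrite divr_ge0// ler0n.
  by rewrite -mulr_suml -natr_sum -mdegE mr divff.
by move=> i; rewrite mulrC divfK// natr_nat.
Qed.

Lemma grid_mnmP (R : realType) (n r : nat) (x : 'I_n -> R) :
  grid R n r x -> exists2 m, mdeg m = r & forall i, r%:R * x i = (m i)%:R.
Proof.
move=> [[x0 x1] xr]; exists [multinom Num.truncn (r%:R * x i) | i < n] => [|i].
  apply/eqP; rewrite -(eqr_nat R) mdegE natr_sum.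
  under eq_bigr do rewrite mnmE truncnK//.
  by rewrite -mulr_sumr x1 mulr1.
by rewrite mnmE truncnK.
Qed.

Lemma min_on_grid_le (R : realType) (n r : nat) (f : {mpoly R[n]}) (x : 'I_n -> R) :
  (0 < n)%N -> (0 < r)%N -> grid R n r x -> min_on (grid R n r) f <= f.@[x].
Proof.
move=> n0 r0 gx.
have rn0 : r%:R != 0 :> R by rewrite pnatr_eq0 -lt0n.
have [m mr mmin] := mdeg_arg_min r (fun m => f.@[fun i => (m i)%:R / r%:R]) n0.
apply: (@min_of_lbound _ _ f.@[fun i => (m i)%:R / r%:R]); last by exists x.
  by exists (fun i => (m i)%:R / r%:R) => //; exact: grid_mnm.
move=> _ [y /grid_mnmP[m' m'r yE] <-].
rewrite (_ : f.@[y] = f.@[fun i => (m' i)%:R / r%:R]); first exact: mmin.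
by apply: meval_eq => i; rewrite -yE mulrAC divff// mul1r.
Qed.

(** * The final estimate *)

(** Here t = r, v = f(x), q = Q(x), s = L(x), G is the grid minimum, and M and mm are the extrema on
    the simplex. *)
Lemma cubic_gap_le (R : realFieldType) (t v q s G M mm : R) :
  3 <= t -> G <= v -> mm <= v -> mm <= s -> q <= 8 * M - 2 * s ->
  G - (t ^+ 3 * v - t ^+ 2 * (q / 2) + 2 * t * s) / (t * (t - 1) * (t - 2))
    <= 4 * t / ((t - 1) * (t - 2)) * (M - mm).
Proof.
move=> t3 Gv vm sm qM.
have K0 : 0 < (t - 1) * (t - 2) by apply: mulr_gt0; lra.
have -> : (t ^+ 3 * v - t ^+ 2 * (q / 2) + 2 * t * s) / (t * (t - 1) * (t - 2))
  = (t ^+ 2 * v - t * (q / 2) + 2 * s) / ((t - 1) * (t - 2)).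
  by field; apply/and3P; split; apply/eqP; lra.
apply: le_trans (lerD Gv (lexx _)) _.
rewrite lerBlDr [4 * t / _ * _]mulrAC -mulrDl ler_pdivlMr//.
(* The right side minus the left is h1 / 2 + h2 + h3. The constant 4 arises as 8 / 2 at M, and from
   (t + 2) + (3 t - 2) = 4 t at mm. *)
have h1 : 0 <= t * (8 * M - 2 * s - q) by apply: mulr_ge0; lra.
have h2 : 0 <= (t + 2) * (s - mm) by apply: mulr_ge0; lra.
have h3 : 0 <= (3 * t - 2) * (v - mm) by apply: mulr_ge0; lra.
nra.
Qed.

Unset Implicit Arguments.

Theorem theorem4 (R : realType) (n : nat) (hn : (1 <= n)%N)
  (f : {mpoly R[n]}) (hf : f \is 3.-homog) (r : nat) (hr : (3 <= r)%N) :
  min_on (grid R n r) f - polya_bound 3 r f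
    <= 4 * r%:R / ((r%:R - 1) * (r%:R - 2))
       * (max_on (simplex R n) f - min_on (simplex R n) f).
Proof.
(* The exponent attaining the Polya bound yields the grid point x = m / r, whose value dominates the
   grid minimum. *)
have [m mr ->] := polya_boundP hn hr hf.
have r_gt0 : (0 < r)%N by apply: leq_trans hr.
pose x i : R := (m i)%:R / r%:R.
have gx : grid R n r x by exact: grid_mnm.
have Dx : simplex R n x by case: gx.
have rx i : (m i)%:R = r%:R * x i by rewrite mulrC divfK// pnatr_eq0 -lt0n.
rewrite (egf_coef_cubic hf _ rx); last by rewrite subnK.
(* This isolates (r-3)!, which cancels against the factor k! of the coefficient formula. *)
have -> : r`!%:R = r%:R * (r%:R - 1) * (r%:R - 2) * (r - 3)`!%:R :> R.
  case: r hr {mr gx Dx rx r_gt0 x} => [|[|[|k]]]// _.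
  by rewrite !subSS subn0 !factS !natrM -!natr1; ring.
have k0 : (r - 3)`!%:R != 0 :> R by rewrite pnatr_eq0 -lt0n fact_gt0.
rewrite (mulrC _ (r - 3)`!%:R) -mulf_div divff// mul1r.
have fD y Dy := andP (@simplex_extrema R n f y Dy).
apply: cubic_gap_le.
- by rewrite ler_nat.
- exact: min_on_grid_le.
- by case: (fD x Dx).
- exact: vertex_form_ge (fun y Dy => (fD y Dy).1) Dx.
- exact: edge_form_le (fun y Dy => (fD y Dy).2) Dx.
Qed.
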